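(* Let $n\ge 1$. The map $\Phi_n$ that sends a form $f_n(T,U)\in\mathcal{A}_n$ to the form $$g_n(X,Y)=f_n\big(i(X+iY),\,i(X-iY)\big)$$ is an isomorphism (of real vector spaces) from $\mathcal{A}_n$ onto $\mathcal{F}_n$.
   Context: $\mathcal{A}_n$ is the real vector space of all complex binary forms $$f_n(T,U)=\sum_{k=0}^{n+1}(-1)^k\zeta_kT^{n+1-k}U^k,\qquad \zeta_k\in\mathbb{C},\quad \zeta_k=\overline{\zeta_{n+1-k}}\ \ (k=0,\dots,n+1).$$ $\mathcal{F}_n$ is the real vector space of all real binary forms $g_n(X,Y)=\sum_{j=0}^{n+1}a_jX^{n+1-j}Y^j$ with $a_0,\dots,a_{n+1}\in\mathbb{R}$ (it is not assumed that $a_0\neq 0$). Here $i=\sqrt{-1}$. *)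

(* Defs.v *)
From HB Require Import structures.
From mathcomp Require Import all_boot all_order all_algebra.
From mathcomp Require Import boolp reals.
From mathcomp Require Import complex.
From mathcomp Require Import mpoly.

Set Implicit Arguments.
Unset Strict Implicit.
Unset Printing Implicit Defensive.

Import Order.TTheory GRing.Theory Num.Theory.
Local Open Scope ring_scope.
Local Open Scope complex_scope.

Section Forms.
Variables (R : realType) (n : nat).

(* In {mpoly R[i][2]}, 'X_0 and 'X_1 are the two variables (T, U), resp. (X, Y).
   rev_ord k : 'I_n.+2 has value n + 1 - k. *)
Definition signed_form (zeta : 'I_n.+2 -> R[i]) : {mpoly R[i][2]} :=
  \sum_(k < n.+2) ((-1) ^+ k * zeta k) *: ('X_0 ^+ (n.+1 - k) * 'X_1 ^+ k).

Definition Apred : {pred {mpoly R[i][2]}} :=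
  fun f => `[< exists zeta : 'I_n.+2 -> R[i],
                 (forall k, zeta k = (zeta (rev_ord k))^*) /\
                 f = signed_form zeta >].

Lemma ApredP f :
  reflect (exists zeta : 'I_n.+2 -> R[i],
             (forall k, zeta k = (zeta (rev_ord k))^*) /\ f = signed_form zeta)
          (f \in Apred).
Proof. exact: asboolP. Qed.

Lemma Apred_zmod_closed : zmod_closed Apred.
Proof.
split.
  apply/ApredP; exists (fun=> 0); split=> [k|]; first by rewrite rmorph0.
  by rewrite /signed_form big1 // => k _; rewrite mulr0 scale0r.
move=> _ _ /ApredP[z [zE ->]] /ApredP[w [wE ->]]; apply/ApredP.
exists (fun k => z k - w k); split=> [k|]; first by rewrite rmorphB /= -zE -wE.
rewrite /signed_form -sumrB; apply: eq_bigr => k _.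
by rewrite mulrBr scalerBl.
Qed.

HB.instance Definition _ :=
  GRing.isZmodClosed.Build {mpoly R[i][2]} Apred Apred_zmod_closed.

Lemma Apred_scale (a : R) f : f \in Apred -> a%:C *: f \in Apred.
Proof.
move=> /ApredP[z [zE ->]]; apply/ApredP.
exists (fun k => a%:C * z k); split=> [k|].
  by rewrite rmorphM /= oppr0 -zE.
rewrite /signed_form scaler_sumr; apply: eq_bigr => k _.
by rewrite scalerA mulrCA.
Qed.

Record Aform : Type := AForm {
  Aform_val :> {mpoly R[i][2]}; _ : Aform_val \in Apred }.

HB.instance Definition _ := [isSub for Aform_val].
HB.instance Definition _ := [Choice of Aform by <:].
HB.instance Definition _ := [SubChoice_isSubZmodule of Aform by <:].

Lemma Aform_in (f : Aform) : Aform_val f \in Apred.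
Proof. exact: valP. Qed.

Definition Aform_scale (a : R) (f : Aform) : Aform :=
  AForm (Apred_scale a (Aform_in f)).

Fact Aform_scaleA a b f :
  Aform_scale a (Aform_scale b f) = Aform_scale (a * b) f.
Proof. by apply/val_inj; rewrite /= scalerA rmorphM. Qed.
Fact Aform_scale1 : left_id 1 Aform_scale.
Proof. by move=> f; apply/val_inj; rewrite /= rmorph1 scale1r. Qed.
Fact Aform_scaleDr : right_distributive Aform_scale +%R.
Proof. by move=> a f g; apply/val_inj; rewrite /= scalerDr. Qed.
Fact Aform_scaleDl f : {morph Aform_scale^~ f : a b / a + b}.
Proof. by move=> a b; apply/val_inj; rewrite /= rmorphD scalerDl. Qed.

(* Only real scalars act on Aform: the symmetry condition is not stable under
   multiplication by 'i. *)
HB.instance Definition _ := GRing.Zmodule_isLmodule.Build R Aform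
  Aform_scaleA Aform_scale1 Aform_scaleDr Aform_scaleDl.

End Forms.

Definition Phi_subst (R : realType) (f : {mpoly R[i][2]}) : {mpoly R[i][2]} :=
  f \mPo [tuple 'i *: ('X_0 + 'i *: 'X_1); 'i *: ('X_0 - 'i *: 'X_1)].

(* Main.v *)
(* The substitution (T, U) = (i(X + iY), i(X - iY)) is invertible over the complex
   numbers, with inverse X = -i(T + U)/2, Y = (U - T)/2, and preserves degrees.
   For real X, Y one has conj T = - U and conj U = - T, so complex conjugation of
   coefficients on the (X, Y) side corresponds on the (T, U) side to the
   conjugate-linear involution f(T, U) |-> conj f (- U, - T). A form of degree
   n + 1 is fixed by this involution exactly when it lies in A_n, so the
   substitution matches A_n with the forms having real coefficients. *)

Require Import Defs.
From HB Require Import structures.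
From mathcomp Require Import all_boot all_order all_algebra.
From mathcomp Require Import boolp reals.
From mathcomp Require Import complex.
From mathcomp Require Import mpoly.
From mathcomp Require Import ring.

Set Implicit Arguments.
Unset Strict Implicit.
Unset Printing Implicit Defensive.

Import Order.TTheory GRing.Theory Num.Theory.
Local Open Scope ring_scope.
Local Open Scope complex_scope.

Lemma ord2_ind (P : 'I_2 -> Prop) : P ord0 -> P ord_max -> forall i, P i.
Proof.
move=> P0 P1 i; case: (unliftP ord0 i) => [j|] -> //; rewrite (ord1 j).
by rewrite (_ : lift _ _ = ord_max) //; apply: val_inj.
Qed.

(** * Composition of polynomial substitutions, and homogeneity under linear ones *)

Section Composition.
Context (n k l : nat) (C : comNzRingType).

Lemma comp_mpolyA (p : {mpoly C[n]}) (s : n.-tuple {mpoly C[k]})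
    (t : k.-tuple {mpoly C[l]}) :
  (p \mPo s) \mPo t = p \mPo [tuple tnth s i \mPo t | i < n].
Proof.
rewrite (comp_mpolyEX p s) (comp_mpolyEX p _) raddf_sum /=.
apply: eq_bigr => m _; rewrite comp_mpolyZ !comp_mpolyX rmorph_prod /=.
by congr (_ *: _); apply: eq_bigr => i _; rewrite rmorphXn tnth_mktuple.
Qed.

Lemma dhomog_comp_mpoly d (p : {mpoly C[n]}) (t : n.-tuple {mpoly C[k]}) :
  p \is d.-homog -> (forall i, tnth t i \is 1.-homog) -> p \mPo t \is d.-homog.
Proof.
move=> /dhomogP hp ht; rewrite comp_mpolyE big_seq; apply: rpred_sum => m /hp /= <-.
apply: rpredZ; rewrite mdegE.
elim/big_ind2: _ => [|e q f r|i _]; first exact: dhomog1.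
- exact: dhomogM.
by have := dhomogMn (m i) (ht i); rewrite mul1n.
Qed.

End Composition.

(** * Maps applied coefficientwise to polynomials *)

Section CoefficientMaps.
Context (n : nat) (A B : nzRingType).
Implicit Types (p : {mpoly A[n]}) (q : {mpoly B[n]}).

Lemma map_mpoly_homog d (s : {additive A -> B}) p :
  p \is d.-homog -> map_mpoly s p \is d.-homog.
Proof.
move=> hp; apply/dhomogP => m; rewrite mcoeff_msupp mcoeff_map_mpoly => sm.
by apply/eqP; apply: contraNT sm => /(dhomog_nemf_coeff hp)->; rewrite raddf0.
Qed.

Lemma map_mpoly_inj (s : {additive A -> B}) :
  injective s -> injective (map_mpoly (n := n) s).
Proof.
move=> sI p q pq; apply/mpolyP => m; apply: sI.
by rewrite -!mcoeff_map_mpoly pq.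
Qed.

Lemma map_mpoly_fixed (iota : {additive A -> B}) (s : {additive B -> B}) p :
  (forall a, s (iota a) = iota a) ->
  map_mpoly s (map_mpoly iota p) = map_mpoly iota p.
Proof.
by move=> siota; apply/mpolyP => m; rewrite !mcoeff_map_mpoly siota.
Qed.

(** Descent of conjugation-invariant polynomials to real ones: [s] will be conjugation, [r] the real
    part and [iota] the inclusion of the reals. *)
Lemma map_mpoly_fixed_lift (s : {additive B -> B}) (r : {additive B -> A})
    (iota : {additive A -> B}) q :
  (forall b, s b = b -> iota (r b) = b) ->
  map_mpoly s q = q -> map_mpoly iota (map_mpoly r q) = q.
Proof.
move=> sr sq; apply/mpolyP => m; rewrite !mcoeff_map_mpoly; apply: sr.
by rewrite -mcoeff_map_mpoly sq.
Qed.

Lemma map_mpoly_linear (s : {rmorphism A -> B}) a p p' :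
  map_mpoly s (a *: p + p') = s a *: map_mpoly s p + map_mpoly s p'.
Proof. by rewrite raddfD /= map_mpolyZ. Qed.

End CoefficientMaps.

(** * Binary forms and their coefficients *)

Section BinaryForms.
Context (C : comNzRingType) (d : nat).
Implicit Types (c : 'I_d.+1 -> C) (p : {mpoly C[2]}).

Definition binary_form c : {mpoly C[2]} :=
  \sum_(k < d.+1) c k *: ('X_0 ^+ (d - k) * 'X_1 ^+ k).

(** The subtraction is truncated, so the total degree is [d] only for [k <= d]. *)
Definition binary_monomial (k : nat) : 'X_{1..2} :=
  [multinom if i == ord0 then (d - k)%N else k | i < 2].

Lemma mpolyX_binary_monomial k :
  'X_[C, binary_monomial k] = 'X_0 ^+ (d - k) * 'X_1 ^+ k.
Proof.
by rewrite mpolyXE_id !big_ord_recl big_ord0 mulr1 !mnmE /=.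
Qed.

Lemma mdeg_binary_monomial k : (k <= d)%N -> mdeg (binary_monomial k) = d.
Proof.
by move=> kd; rewrite mdegE !big_ord_recl big_ord0 !mnmE /= addn0 subnK.
Qed.

Lemma binary_form_homog c : binary_form c \is d.-homog.
Proof.
apply: rpred_sum => k _; apply: rpredZ.
by rewrite -mpolyX_binary_monomial dhomogX /= mdeg_binary_monomial // -ltnS.
Qed.

Lemma mcoeff_binary_form c (k : 'I_d.+1) :
  (binary_form c)@_(binary_monomial k) = c k.
Proof.
rewrite raddf_sum (bigD1 k) //= big1 ?addr0 => [|j jk].
  by rewrite mcoeffZ -mpolyX_binary_monomial mcoeffX eqxx mulr1.
rewrite mcoeffZ -mpolyX_binary_monomial mcoeffX.
case: eqP => [/mnmP/(_ ord_max)|_]; last by rewrite mulr0.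
by rewrite !mnmE /= => /ord_inj jkE; rewrite jkE eqxx in jk.
Qed.

(** A bivariate exponent of total degree [d] is determined by its second entry, which is at most
    [d]; at any other degree both coefficients vanish. *)
Lemma binary_form_mcoeff p :
  p \is d.-homog -> p = binary_form (fun k => p@_(binary_monomial k)).
Proof.
move=> hp; apply/mpolyP => m.
have [md|md] := eqVneq (mdeg m) d; last first.
  by rewrite !(dhomog_nemf_coeff _ md) // binary_form_homog.
have m1d : (m ord_max < d.+1)%N.
  by rewrite ltnS -md mdegE (bigD1 ord_max) //= leq_addr.
have -> : m = binary_monomial (Ordinal m1d).
  apply/mnmP => i; rewrite mnmE /=; case: eqVneq => [->|i0].
    move: md; rewrite mdegE !big_ord_recl big_ord0 addn0 => <-.
    by rewrite (_ : lift _ _ = ord_max) ?addnK //; apply: val_inj.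
  by congr (m _); apply: val_inj; case: i i0 => [[|[|]]].
by rewrite mcoeff_binary_form.
Qed.

End BinaryForms.

(** * The substitution and its inverse, with [I] and [h] standing for i and 1/2 *)

Section LinearSubstitutions.
Context (C : comNzRingType) (I h : C) (II : I * I = -1) (hh : h + h = 1).
Implicit Types p : {mpoly C[2]}.

Definition phi_subst p : {mpoly C[2]} :=
  p \mPo [tuple I *: ('X_0 + I *: 'X_1); I *: ('X_0 - I *: 'X_1)].

Definition psi_subst p : {mpoly C[2]} :=
  p \mPo [tuple (- (I * h)) *: ('X_0 + 'X_1); h *: ('X_1 - 'X_0)].

Lemma comp_mpoly_id2 (t : 2.-tuple {mpoly C[2]}) p :
  tnth t ord0 = 'X_0 -> tnth t ord_max = 'X_1 -> p \mPo t = p.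
Proof.
move=> t0 t1; rewrite -[RHS]comp_mpoly_id; congr (comp_mpoly _ p).
by apply: eq_from_tnth; apply: ord2_ind; rewrite tnth_mktuple ?t0 ?t1.
Qed.

Let II' : I%:MP_[2] * I%:MP_[2] = -1.
Proof. by rewrite -mpolyCM II mpolyCN mpolyC1. Qed.

Let hh' : h%:MP_[2] + h%:MP_[2] = 1.
Proof. by rewrite -mpolyCD hh mpolyC1. Qed.

Lemma phi_substK p : psi_subst (phi_subst p) = p.
Proof.
rewrite /psi_subst /phi_subst comp_mpolyA.
apply: comp_mpoly_id2; rewrite tnth_mktuple (tnth_nth 0) /=
  !(comp_mpolyZ, comp_mpolyD, comp_mpolyN, comp_mpolyXU) /= -!mul_mpolyC
  mpolyCN mpolyCM;
  move: ('X_0) ('X_1) (I%:MP_[2]) (h%:MP_[2]) II' hh' => x y i k ii kk.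
  (* Each variable comes back multiplied by -(i * i)(k + k), identically in i and k; the relations i
     * i = -1 and k + k = 1 make this factor 1. *)
  by transitivity (- (i * i) * (k + k) * x); [ring | rewrite ii kk; ring].
by transitivity (- (i * i) * (k + k) * y); [ring | rewrite ii kk; ring].
Qed.

Lemma psi_substK p : phi_subst (psi_subst p) = p.
Proof.
rewrite /psi_subst /phi_subst comp_mpolyA.
apply: comp_mpoly_id2; rewrite tnth_mktuple (tnth_nth 0) /=
  !(comp_mpolyZ, comp_mpolyD, comp_mpolyN, comp_mpolyXU) /= -!mul_mpolyC
  ?mpolyCN ?mpolyCM;
  move: ('X_0) ('X_1) (I%:MP_[2]) (h%:MP_[2]) II' hh' => x y i k ii kk.
  by transitivity (- (i * i) * (k + k) * x); [ring | rewrite ii kk; ring].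
by transitivity (- (i * i) * (k + k) * y); [ring | rewrite ii kk; ring].
Qed.

Lemma phi_subst_homog d p : p \is d.-homog -> phi_subst p \is d.-homog.
Proof.
move=> hp; apply: dhomog_comp_mpoly => //.
have X1 j : 'X_j \is [in C[2], 1.-homog] by rewrite dhomogX /= mdeg1.
by apply: ord2_ind; rewrite (tnth_nth 0) /=;
  apply/rpredZ; (apply: rpredB || apply: rpredD); rewrite ?rpredZ ?X1.
Qed.

Lemma psi_subst_homog d p : p \is d.-homog -> psi_subst p \is d.-homog.
Proof.
move=> hp; apply: dhomog_comp_mpoly => //.
have X1 j : 'X_j \is [in C[2], 1.-homog] by rewrite dhomogX /= mdeg1.
by apply: ord2_ind; rewrite (tnth_nth 0) /=;
  apply/rpredZ; (apply: rpredB || apply: rpredD); rewrite ?rpredZ ?X1.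
Qed.

End LinearSubstitutions.

(** * The conjugate-linear involution and its fixed forms *)

Section Conjugation.
Context (C : comNzRingType) (sigma : {rmorphism C -> C}).
Implicit Types p : {mpoly C[2]}.

Definition swap_conj p : {mpoly C[2]} :=
  map_mpoly sigma p \mPo [tuple - 'X_1; - 'X_0].

(** Since [sigma I = - I], [sigma] takes I(X + IY) to -I(X - IY) and I(X - IY) to -I(X + IY). *)
Lemma map_phi_subst I p : injective sigma -> sigma I = - I ->
  map_mpoly sigma (phi_subst I p) = phi_subst I (swap_conj p).
Proof.
move=> sI sigmaI; rewrite /phi_subst map_mpoly_comp // comp_mpolyA.
congr (comp_mpoly _ _); apply: eq_from_tnth.
by apply: ord2_ind; rewrite tnth_mktuple tnth_map !(tnth_nth 0) /= comp_mpolyN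
  comp_mpolyXU /= map_mpolyZ rmorphD ?rmorphN /= map_mpolyZ !map_mpolyX sigmaI !scaleNr ?opprK.
Qed.

(** By injectivity of [phi_subst] both sides may be compared after applying it; there the involution
    becomes [sigma], which fixes [p]. *)
Lemma swap_conj_psi_subst I h p : injective sigma -> sigma I = - I ->
    I * I = -1 -> h + h = 1 -> map_mpoly sigma p = p ->
  swap_conj (psi_subst I h p) = psi_subst I h p.
Proof.
move=> sI sigmaI II hh pE; apply: (can_inj (phi_substK II hh)).
by rewrite -map_phi_subst // !psi_substK.
Qed.

(** The substitution turns the monomial of index k into (-U)^(d-k) (-T)^k: the index is reversed and
    the signs combine to (-1)^d. *)
Lemma swap_conj_binary_form d (c : 'I_d.+1 -> C) :
  swap_conj (binary_form c)
  = binary_form (fun k => (-1) ^+ d * sigma (c (rev_ord k))).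
Proof.
rewrite /swap_conj /binary_form (raddf_sum (map_mpoly sigma)) raddf_sum.
rewrite (reindex_inj rev_ord_inj) /=.
apply: eq_bigr => k _; rewrite subSS map_mpolyZ comp_mpolyZ.
have kd : (k <= d)%N by rewrite -ltnS.
rewrite !rmorphM !rmorphXn /= !map_mpolyX !comp_mpolyXU /= subKn //.
rewrite ![(- 'X__) ^+ _]exprNn mulrACA -exprD subnKC // mulrC.
rewrite (mulrC ((-1) ^+ d) (sigma _)) -scalerA; congr (_ *: _).
rewrite (_ : (-1) ^+ d = ((-1) ^+ d)%:MP);
  last by rewrite rmorphXn /= mpolyCN mpolyC1.
by rewrite -[RHS]mul_mpolyC mulrC (mulrC ('X_0 ^+ _)).
Qed.

(** Because (-1)^d (-1)^(d-k) = (-1)^k, comparing coefficients of a fixed form whose coefficients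
    are written (-1)^k zeta_k gives exactly the symmetry of zeta. *)
Lemma swap_conj_fixedP d p :
  (exists zeta : 'I_d.+1 -> C, (forall k, zeta k = sigma (zeta (rev_ord k))) /\
     p = binary_form (fun k => (-1) ^+ k * zeta k))
  <-> p \is d.-homog /\ swap_conj p = p.
Proof.
have sgn (k : 'I_d.+1) : (-1) ^+ d * (-1) ^+ rev_ord k = (-1) ^+ k :> C.
  have kd : (k <= d)%N by rewrite -ltnS.
  rewrite -exprD /= subSS -{1}(subnK kd) addnAC addnn.
  by rewrite exprD -mul2n exprM sqrrN expr1n expr1n mul1r.
split=> [[zeta [zetaE ->]]|[hp pE]].
  split; first exact: binary_form_homog.
  rewrite swap_conj_binary_form; apply: eq_bigr => k _.
  by rewrite rmorphM rmorphXn rmorphN1 -zetaE mulrA sgn.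
(* The sign (-1)^k is its own inverse, so multiplying by it recovers zeta from the coefficients. *)
exists (fun k => (-1) ^+ k * p@_(binary_monomial d k)); split=> [k|].
  have /(congr1 (mcoeff (binary_monomial d k))) := pE.
  rewrite {1}(binary_form_mcoeff hp) swap_conj_binary_form.
  rewrite mcoeff_binary_form => <-.
  by rewrite rmorphM rmorphXn rmorphN1 mulrA -(sgn k); congr (_ * _);
    rewrite mulrAC -exprD addnn -mul2n exprM sqrrN expr1n expr1n mul1r.
rewrite {1}(binary_form_mcoeff hp); apply: eq_bigr => k _.
by rewrite mulrA -exprD addnn -mul2n exprM sqrrN expr1n expr1n mul1r.
Qed.

End Conjugation.

(** * The real-linear isomorphism and its inverse *)

Section Phi.
Context (R : realType) (n : nat).
Local Notation C := R[i].
Local Notation toC := (real_complex R).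
Implicit Types f g : {mpoly C[2]}.

Lemma conjc_inj : injective (@conjc R).
Proof. exact: (can_inj (@conjcK R)). Qed.

Lemma conjc_i : conjc 'i%C = - 'i%C :> C.
Proof. by apply/eqP; rewrite eq_complex /= oppr0 !eqxx. Qed.

Lemma AformP f :
  f \in Apred n <-> f \is n.+1.-homog /\ swap_conj (@conjc R) f = f.
Proof.
(* [signed_form] is convertible to a [binary_form] of degree n + 1 with the signs absorbed into the
   coefficients. *)
exact: (iff_trans (iff_sym (rwP (ApredP n f)))
                  (@swap_conj_fixedP C (@conjc R) n.+1 f)).
Qed.

Lemma Phi_substE f : Phi_subst f = phi_subst 'i%C f.
Proof. by rewrite complexiE. Qed.

Lemma Re_is_additive : additive (@complex.Re R : C -> R).
Proof. by move=> [a b] [c d]. Qed.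

HB.instance Definition _ :=
  GRing.isAdditive.Build C R (@complex.Re R) Re_is_additive.

Lemma map_mpoly_Re g : map_mpoly conjc g = g ->
  map_mpoly toC (map_mpoly (@complex.Re R) g) = g.
Proof.
apply: (@map_mpoly_fixed_lift _ _ _ conjc (@complex.Re R) toC) => -[x y] [yN].
(* Invariance under conjugation says -y = y, which forces y = 0. *)
by congr (_ +i* _); apply/eqP; rewrite eq_sym -eqNr yN.
Qed.

Lemma map_mpoly_conjc_real (p : {mpoly R[2]}) :
  map_mpoly conjc (map_mpoly toC p) = map_mpoly toC p.
Proof. exact: (@map_mpoly_fixed 2 R C toC conjc p (@conjc_real R)). Qed.

Lemma map_mpoly_complexI : injective (map_mpoly (n := 2) toC).
Proof. exact: (@map_mpoly_inj 2 R C toC (@complexI R)). Qed.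

Let half : C := 2^-1.

Let half2 : half + half = 1.
Proof. by rewrite -mulr2n -mulr_natr mulVf // pnatr_eq0. Qed.

Let ii : 'i%C * 'i%C = -1 :> C.
Proof. by rewrite -expr2 sqr_i. Qed.

Lemma Phi_subst_conjc (f : Aform R n) :
  map_mpoly conjc (Phi_subst (Aform_val f)) = Phi_subst (Aform_val f).
Proof.
have [_ fE] := (AformP _).1 (Aform_in f).
by rewrite !Phi_substE (map_phi_subst _ conjc_inj conjc_i) fE.
Qed.

Lemma Phi_homog (f : Aform R n) :
  map_mpoly (@complex.Re R) (Phi_subst (Aform_val f)) \is n.+1.-homog.
Proof.
apply: map_mpoly_homog; rewrite Phi_substE; apply: phi_subst_homog.
by have [] := (AformP _).1 (Aform_in f).
Qed.

(** Taking real parts coefficientwise lands in real forms at once; nothing is lost, since the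
    substituted form is invariant under conjugation. *)
Definition Phi (f : Aform R n) : dhomog 2 R n.+1 := DHomog (Phi_homog f).

Lemma PhiE (f : Aform R n) :
  map_mpoly (real_complex R) (Phi f) = Phi_subst (Aform_val f).
Proof. exact/map_mpoly_Re/Phi_subst_conjc. Qed.

Lemma Phi_is_linear : linear Phi.
Proof.
move=> a f g; apply/val_inj/map_mpoly_complexI.
(* Rewriting with PhiE does not terminate: R[i] and R carry several ring
   structures whose comparison diverges. Hence the explicit transitivity. *)
apply: (etrans (PhiE _)).
apply: (etrans _ (esym (map_mpoly_linear toC a (Phi f) (Phi g)))).
have -> : Phi_subst (Aform_val (a *: f + g))
    = a%:C *: Phi_subst (Aform_val f) + Phi_subst (Aform_val g).
  by rewrite /Phi_subst /= comp_mpolyD comp_mpolyZ.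
exact: (f_equal2 (fun u v => a%:C *: u + v) (esym (PhiE f)) (esym (PhiE g))).
Qed.

HB.instance Definition _ :=
  GRing.isLinear.Build R (Aform R n) (dhomog 2 R n.+1) _ Phi Phi_is_linear.

(** This provides the inverse map: a real form is invariant under conjugation, so the inverse
    substitution yields a form fixed by the involution. *)
Lemma Psi_in (g : dhomog 2 R n.+1) :
  psi_subst 'i%C half (map_mpoly (real_complex R) g) \in Apred n.
Proof.
apply/AformP; split.
  exact/psi_subst_homog/map_mpoly_homog/dhomog_is_dhomog.
apply: (swap_conj_psi_subst conjc_inj conjc_i ii half2).
exact: map_mpoly_conjc_real.
Qed.

Lemma Phi_bij : bijective Phi.
Proof.
exists (fun g : dhomog 2 R n.+1 => AForm (Psi_in g)) => [f|g].
  apply: val_inj; apply: etrans (phi_substK ii half2 (Aform_val f)).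
  exact: (congr1 (psi_subst 'i%C half) (etrans (PhiE f) (Phi_substE _))).
apply/val_inj/map_mpoly_complexI.
apply: (etrans (PhiE _)); apply: (etrans (Phi_substE _)).
exact: (psi_substK ii half2).
Qed.

End Phi.

Theorem proposition2p1 (R : realType) (n : nat) (hn : (1 <= n)%N) :
  exists Phi : {linear Aform R n -> dhomog 2 R n.+1},
    (forall f : Aform R n,
       map_mpoly (real_complex R) (mpoly_of_dhomog (Phi f))
       = Phi_subst (Aform_val f))
    /\ bijective Phi.
Proof.
exists (@Phi R n : {linear Aform R n -> dhomog 2 R n.+1}); split.
  exact: PhiE.
exact: Phi_bij.
Qed.
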